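(* Let $\mathbb{F}$ be an infinite field, let $n\ge1$, and let $L$ be a lower-triangular $n\times n$ matrix with entries in $\mathbb{F}$ having diagonal entries $\lambda_0,\ldots,\lambda_{n-1}$ read from top to bottom. Then $L$ has global anti-diagonal eigenbasis action if and only if $L$ is equal to the binomial transform $H^{(\lambda_0,\ldots,\lambda_{n-1})}$.
   Context: Rows and columns of matrices are numbered from $0$. $J(m)$ is the $m\times m$ matrix with $J(m)_{xy}=1$ if $x+y=m-1$ and $0$ otherwise. $B(n)$ is the $n\times n$ matrix with $B(n)_{xy}=\binom{x}{y}$ (image in $\mathbb{F}$). The binomial transform is $H^{(\lambda_0,\ldots,\lambda_{n-1})}=B(n)\,\mathrm{Diag}(\lambda_0,\ldots,\lambda_{n-1})\,B(n)^{-1}$. An invertible lower-triangular $n\times n$ matrix $Q$ over $\mathbb{F}$ is an anti-diagonal conjugator if $Q^{-1}J(n)Q$ is upper-triangular with diagonal entries $(Q^{-1}J(n)Q)_{xx}=(-1)^x$. It is a global anti-diagonal conjugator if the same holds for all the top-left $m\times m$ submatrices of $Q$, $1\le m\le n$, replacing $J(n)$ with $J(m)$. A lower-triangular matrix $L$ has global anti-diagonal eigenbasis action if there is a global anti-diagonal conjugator $Q$ all of whose columns are eigenvectors of $L$ (i.e. $Q^{-1}LQ$ is diagonal). *)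

(* Defs.v *)
From mathcomp Require Import all_boot all_order all_algebra.
From mathcomp Require Import classical_sets cardinality.

Set Implicit Arguments.
Unset Strict Implicit.
Unset Printing Implicit Defensive.

Import GRing.Theory.
Local Open Scope ring_scope.

Definition antidiag_mx (F : fieldType) (m : nat) : 'M[F]_m :=
  \matrix_(x < m, y < m) ((x + y)%N == m.-1)%:R.

Definition binom_mx (F : fieldType) (n : nat) : 'M[F]_n :=
  \matrix_(x < n, y < n) 'C(x, y)%:R.

Definition binomial_transform (F : fieldType) (n : nat) (lam : 'rV[F]_n) :
    'M[F]_n :=
  binom_mx F n *m diag_mx lam *m invmx (binom_mx F n).

(* [is_trig_mx] means lower-triangular in MathComp. *)
Definition lower_triangular (F : fieldType) (n : nat) (A : 'M[F]_n) : bool :=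
  is_trig_mx A.

Definition upper_triangular (F : fieldType) (n : nat) (A : 'M[F]_n) : bool :=
  is_trig_mx A^T.

Definition antidiag_conjugator (F : fieldType) (n : nat) (Q : 'M[F]_n) : Prop :=
  let T := invmx Q *m antidiag_mx F n *m Q in
  [/\ Q \in unitmx, lower_triangular Q, upper_triangular T
    & forall x : 'I_n, T x x = (-1) ^+ x].

Definition top_left (F : fieldType) (n m : nat) (le_mn : (m <= n)%N)
    (Q : 'M[F]_n) : 'M[F]_m :=
  mxsub (widen_ord le_mn) (widen_ord le_mn) Q.

Definition global_antidiag_conjugator (F : fieldType) (n : nat)
    (Q : 'M[F]_n) : Prop :=
  forall (m : nat) (le_mn : (m <= n)%N), (1 <= m)%N ->
    antidiag_conjugator (top_left le_mn Q).

(* MathComp's [eigenspace] and [eigenvalue] concern the action on row vectors;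
   here matrices act on column vectors. *)
Definition col_eigenvector (F : fieldType) (n : nat) (L : 'M[F]_n)
    (v : 'cV[F]_n) : Prop :=
  v != 0 /\ exists mu : F, L *m v = mu *: v.

Definition global_antidiag_eigenbasis_action (F : fieldType) (n : nat)
    (L : 'M[F]_n) : Prop :=
  exists Q : 'M[F]_n, global_antidiag_conjugator Q /\
    forall j : 'I_n, col_eigenvector L (col j Q).

(* Main.v *)
(** Both directions come down to the fact that the global anti-diagonal
    conjugators are the matrices [B D] with [D] invertible diagonal.
    With [w i = (-1)^i 'C(k, i)], the row [w] kills every column [j < k] of [B],
    so pairing [w] with column [k] of [J(m) Q = Q T], once the columns before
    [k] are known, gives [\sum_i w i * Q (m - 1 - i) k = Q k k].  This recursion
    determines column [k] from its diagonal entry, and [x |-> 'C(x, k)]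
    satisfies it. *)
Require Import Defs.
From mathcomp Require Import all_boot all_order all_algebra.
From mathcomp Require Import classical_sets cardinality.

Set Implicit Arguments.
Unset Strict Implicit.
Unset Printing Implicit Defensive.

Import GRing.Theory.
Local Open Scope ring_scope.

Lemma coef_1DXn (R : nzRingType) (n k : nat) :
  ((1 + 'X) ^+ n : {poly R})`_k = 'C(n, k)%:R.
Proof.
elim: n k => [|n IHn] k; first by rewrite expr0 coef1 bin0n.
rewrite exprSr mulrDr mulr1 coefD coefMX !IHn.
by case: k => [|k] /=; rewrite ?bin0 ?addr0 // binS natrD.
Qed.

Lemma coef_signM (R : nzRingType) (n k : nat) (p : {poly R}) :
  ((-1) ^+ n * p)`_k = (-1) ^+ n * p`_k.
Proof. by rewrite -polyC1 -polyCN -polyC_exp coefCM. Qed.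

(** Compare coefficients of ['X^j] in [(1 - (1 + 'X))^k = (- 'X)^k]. *)
Lemma sum_sign_bin_bin (R : comNzRingType) (k j : nat) :
  \sum_(i < k.+1) (-1) ^+ i * 'C(k, i)%:R * 'C(i, j)%:R
    = (-1) ^+ k * (j == k)%:R :> R.
Proof.
have := congr1 (fun p : {poly R} => p`_j) (exprBn 1 (1 + 'X) k).
rewrite opprD addrA subrr add0r [(- 'X) ^+ _]exprNn.
rewrite coef_signM coefXn => ->.
rewrite coef_sum; apply: eq_bigr => i _.
by rewrite expr1n mulr1 coefMn coef_signM coef_1DXn -mulrA mulr_natl mulrnAr.
Qed.

(** Expand [((1 + 'X) - 1)^k] in [(1 + 'X)^(x - k) * 'X^k], whose coefficient at ['X^k] is 1. *)
Lemma sum_sign_bin_subn (R : comNzRingType) (x k : nat) : (k <= x)%N ->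
  \sum_(i < k.+1) (-1) ^+ i * 'C(k, i)%:R * 'C(x - i, k)%:R = 1 :> R.
Proof.
move=> le_kx.
have := congr1 (fun p : {poly R} => ((1 + 'X) ^+ (x - k) * p)`_k)
  (exprBn (1 + 'X) 1 k).
rewrite addrAC subrr add0r coefMXn ltnn subnn coef_1DXn bin0 mulr1n => E.
rewrite [RHS]E mulr_sumr coef_sum; apply: eq_bigr => i _.
have le_ik : (i <= k)%N by rewrite -ltnS.
rewrite expr1n mulr1 [in RHS]mulrnAr coefMn [in RHS]mulrCA -exprD coef_signM.
rewrite coef_1DXn addnBA // subnK //.
by rewrite -mulrA mulr_natl mulrnAr.
Qed.

(** Take the coefficient of ['X^k] after multiplying [(1 + 'X)^(x - i)] by the expansion of
    [1 = ((1 + 'X) - 'X)^i]. The factor ['X^j] in the [j]-th term causes the cutoff at [j <= k]. *)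
Lemma bin_subn_expand (R : comNzRingType) (x i k : nat) : (i <= x)%N ->
  'C(x - i, k)%:R
    = \sum_(j < i.+1) 'C(i, j)%:R *
        (if (j <= k)%N then (-1) ^+ j * 'C(x - j, k - j)%:R else 0) :> R.
Proof.
move=> le_ix.
have := congr1 (fun p : {poly R} => ((1 + 'X) ^+ (x - i) * p)`_k)
  (exprBn (1 + 'X) 'X i).
rewrite addrK expr1n mulr1 coef_1DXn => ->.
rewrite mulr_sumr coef_sum; apply: eq_bigr => j _.
have le_ji : (j <= i)%N by rewrite -ltnS.
rewrite [in LHS]mulrnAr coefMn [in LHS]mulrA [in LHS]mulrCA -exprD -mulrA.
rewrite coef_signM coefMXn coef_1DXn addnBA // subnK // mulr_natl.
by case: ltnP; rewrite ?mulr0.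
Qed.

(** Lets the alternating identities apply to sums over all rows of a matrix: the weights beyond [k]
    vanish. *)
Lemma sum_ord_sign_bin (R : pzRingType) (m k : nat) (F : nat -> R) :
  (k < m)%N ->
  \sum_(i < m) (-1) ^+ i * 'C(k, i)%:R * F i
    = \sum_(i < k.+1) (-1) ^+ i * 'C(k, i)%:R * F i.
Proof.
move=> lt_km; rewrite [RHS](big_ord_widen m (fun i => (-1) ^+ i * 'C(k, i)%:R * F i)) //.
rewrite [RHS]big_mkcond; apply: eq_bigr => i _.
by case: ltnP => // lt_ki; rewrite bin_small // mulr0 mul0r.
Qed.

Section Conjugators.

Variable F : fieldType.

Lemma addn_rev_ord (m : nat) (i : 'I_m) : (i + rev_ord i)%N = m.-1.
Proof. by case: m i => [[]//|m] i; rewrite /= subSS subnKC // -ltnS. Qed.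

Lemma antidiag_mulmxE (m : nat) (A : 'M[F]_m) i k :
  (antidiag_mx F m *m A) i k = A (rev_ord i) k.
Proof.
rewrite mxE (bigD1 (rev_ord i)) //= mxE addn_rev_ord eqxx mul1r.
rewrite big1 ?addr0 // => j ne_j; rewrite mxE -(addn_rev_ord i) eqn_add2l.
by rewrite (inj_eq val_inj) (negPf ne_j) mul0r.
Qed.

Lemma binom_mx_lower (n : nat) : is_trig_mx (binom_mx F n).
Proof. by apply/is_trig_mxP => i j lt_ij; rewrite mxE bin_small. Qed.

Lemma binom_mx_unit (n : nat) : binom_mx F n \in unitmx.
Proof.
rewrite unitmxE det_trig ?binom_mx_lower // big1 ?unitr1 // => i _.
by rewrite mxE binn.
Qed.

Lemma binom_mx_top_left (n m : nat) (le_mn : (m <= n)%N) :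
  top_left le_mn (binom_mx F n) = binom_mx F m.
Proof. by apply/matrixP => i j; rewrite !mxE. Qed.

Lemma binom_mx_conjugator (m : nat) : antidiag_conjugator (binom_mx F m).
Proof.
(* [T] is read off from [bin_subn_expand] at [x = m - 1], which says exactly that [J B = B T]. *)
pose T : 'M[F]_m := \matrix_(j, k)
  (if (j <= k)%N then (-1) ^+ j * 'C(m.-1 - j, k - j)%:R else 0).
have defT : invmx (binom_mx F m) *m antidiag_mx F m *m binom_mx F m = T.
  rewrite -mulmxA; apply: (canLR (mulKmx (binom_mx_unit m))).
  apply/matrixP => i k; rewrite antidiag_mulmxE !mxE /=.
  have [le_im sub_m] : (i <= m.-1)%N /\ (m - i.+1 = m.-1 - i)%N.
    by case: m i {k T} => [[]//|m] i; rewrite subSS -ltnS ltn_ord.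
  rewrite sub_m bin_subn_expand //.
  under [RHS]eq_bigr => j _ do rewrite !mxE.
  rewrite (big_ord_widen m (fun j => 'C(i, j)%:R * (if (j <= k)%N
    then (-1) ^+ j * 'C(m.-1 - j, k - j)%:R else 0))) // big_mkcond.
  apply: eq_bigr => j _.
  by case: ltnP => // lt_ij; rewrite bin_small // mul0r.
split; rewrite ?binom_mx_unit ?defT //; first exact: binom_mx_lower.
  by apply/is_trig_mxP => i j lt_ij; rewrite !mxE leqNgt lt_ij.
by move=> x; rewrite mxE leqnn subnn bin0 mulr1.
Qed.

Lemma col_mul (m n p : nat) (A : 'M[F]_(m, n)) (B : 'M_(n, p)) j :
  col j (A *m B) = A *m col j B.
Proof. by rewrite !colE mulmxA. Qed.

Lemma antidiag_conjugator_recursion (m : nat) (A : 'M[F]_m) (k : 'I_m) :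
    antidiag_conjugator A ->
    (forall i j : 'I_m, (j < k)%N -> A i j = A j j * 'C(i, j)%:R) ->
  \sum_(i < m) (-1) ^+ i * 'C(k, i)%:R * A (rev_ord i) k = A k k.
Proof.
case=> uA /is_trig_mxP trA /is_trig_mxP trT dT colA.
set T := _ *m _ *m _ in trT dT.
have AT : antidiag_mx F m *m A = A *m T by rewrite /T -mulmxA mulKVmx.
under eq_bigr => i _.
  rewrite -antidiag_mulmxE AT mxE mulr_sumr.
  under eq_bigr => j _ do rewrite mulrA.
  over.
(* After the exchange, [T j k] is weighted by the pairing of [w] with column [j] of [A]. For [j = k]
   only row [k] survives: [A] vanishes above it and [w] below it. The sign of [w k] cancels that of
   [T k k]. *)
rewrite exchange_big /= (bigD1 k) //= [X in _ + X]big1 ?addr0 => [|j ne_jk].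
  rewrite -mulr_suml dT (bigD1 k) //= [X in _ + X]big1 ?addr0 => [|i ne_ik].
    by rewrite binn mulr1 mulrAC -expr2 sqrr_sign mul1r.
  have [lt_ik|lt_ki|/val_inj eq_ik] := ltngtP i k.
  - by rewrite trA // mulr0.
  - by rewrite bin_small // mulr0 mul0r.
  - by rewrite eq_ik eqxx in ne_ik.
rewrite -mulr_suml.
(* For [j < k] column [j] of [A] is a multiple of a binomial column, which [w] kills; for [j > k]
   the entry [T j k] is zero. *)
have [lt_jk|lt_kj|/val_inj eq_jk] := ltngtP j k.
- under eq_bigr => i _ do rewrite colA // mulrCA.
  rewrite -mulr_sumr (sum_ord_sign_bin (fun i => 'C(i, j)%:R)) //.
  by rewrite sum_sign_bin_bin (ltn_eqF lt_jk) !mulr0 mul0r.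
- by have := trT k j lt_kj; rewrite mxE => ->; rewrite mulr0.
- by rewrite eq_jk eqxx in ne_jk.
Qed.

(** Strong induction on the column [k], and within it on the row [x]. *)
Lemma global_antidiag_conjugator_col (n : nat) (Q : 'M[F]_n) :
  global_antidiag_conjugator Q ->
  forall x k : 'I_n, Q x k = Q k k * 'C(x, k)%:R.
Proof.
move=> gQ x k; have [b] := ubnP k; elim: b k x => // b IHb k x.
rewrite ltnS => le_kb; have [c] := ubnP x; elim: c x => // c IHc x.
rewrite ltnS => le_xc.
(* In the block of size [x + 1] the last row is [x], so the recursion expresses [Q x k] through rows
   [x - i] with [i > 0]. *)
have gQx := gQ _ (ltn_ord x) isT.
have [lt_xk|le_kx] := ltnP x k.
  have n_gt0 := leq_ltn_trans (leq0n x) (ltn_ord x).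
  have [_ /is_trig_mxP trQ _ _] := gQ n (leqnn n) n_gt0.
  have widen_id y : widen_ord (leqnn n) y = y by exact: val_inj.
  by have := trQ x k lt_xk; rewrite mxE !widen_id bin_small // mulr0.
have lt_kx : (k < x.+1)%N by rewrite ltnS.
pose k' := Ordinal lt_kx.
have wk : widen_ord (ltn_ord x) k' = k by exact: val_inj.
have := antidiag_conjugator_recursion (k := k') gQx.
rewrite [top_left _ _ k' k']mxE wk => recQ.
set A := top_left _ _ in recQ.
have revA (i : 'I_x.+1) : A (rev_ord i) k' = Q (widen_ord (ltn_ord x) (rev_ord i)) k.
  by rewrite mxE wk.
(* Both sequences satisfy the same recursion. By induction on [x] their differences vanish for
   [i > 0], and the remaining term [i = 0] has weight 1. *)
have : \sum_(i < x.+1) (-1) ^+ i * 'C(k, i)%:R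
    * (A (rev_ord i) k' - Q k k * 'C(x - i, k)%:R) = 0.
  under eq_bigr => i _ do rewrite mulrBr.
  rewrite sumrB recQ => [|i j lt_jk]; last first.
    by rewrite !mxE IHb // (leq_trans lt_jk).
  under eq_bigr => i _ do rewrite mulrCA.
  rewrite -mulr_sumr (sum_ord_sign_bin (fun i => 'C(x - i, k)%:R)) //.
  by rewrite sum_sign_bin_subn // mulr1 subrr.
rewrite big_ord_recl big1 ?addr0 => [|i _].
  rewrite expr0 mul1r bin0 mul1r revA subn0 => /eqP; rewrite subr_eq0 => /eqP <-.
  by congr (Q _ k); apply: val_inj; rewrite /= subn1.
rewrite revA IHc ?subrr ?mulr0 //= subSS; apply: leq_trans le_xc.
by rewrite ltn_subrL; case: (x : nat) i => [[]|].
Qed.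

End Conjugators.

Lemma eigenvector_binomial_transform (F : fieldType) (n : nat) (L : 'M[F]_n)
    (lam : 'rV[F]_n) :
    is_trig_mx L -> (forall x, L x x = lam 0 x) ->
    (forall j, col_eigenvector L (col j (binom_mx F n))) ->
  L = binomial_transform lam.
Proof.
move=> /is_trig_mxP trL dL eigB; apply: (canRL (mulmxK (binom_mx_unit F n))).
apply/matrixP => x j; have [_ [mu LBj]] := eigB j.
have eqLB y : (L *m binom_mx F n) y j = mu * 'C(y, j)%:R.
  by have := congr1 (fun v : 'cV_n => v y 0) LBj; rewrite -!col_mul !mxE.
rewrite eqLB mul_mx_diag !mxE mulrC; congr (_ * _).
(* Row [j] identifies the eigenvalue: row [j] of [L] ends where column [j] of [B] begins, with entry
   1, so [mu = L j j]. *)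
rewrite -dL; have := eqLB j; rewrite binn mulr1 => <-.
rewrite mxE (bigD1 j) //= big1 ?addr0 => [|i ne_ij]; first by rewrite mxE binn mulr1.
have [lt_ij|lt_ji|/val_inj eq_ij] := ltngtP i j.
- by rewrite mxE bin_small ?mulr0.
- by rewrite trL ?mul0r.
- by rewrite eq_ij eqxx in ne_ij.
Qed.

Theorem theorem2p9 (F : fieldType) (infinite_F : infinite_set [set: F]%classic)
    (n : nat) (n_ge1 : (1 <= n)%N) (L : 'M[F]_n) (lam : 'rV[F]_n)
    (L_lower : lower_triangular L)
    (L_diag : forall x : 'I_n, L x x = lam 0 x) :
  global_antidiag_eigenbasis_action L <-> L = binomial_transform lam.
Proof.
split=> [[Q [gQ eigQ]] | ->].
  apply: eigenvector_binomial_transform => // j.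
  have colQ : col j Q = Q j j *: col j (binom_mx F n).
    by apply/colP => x; rewrite !mxE (global_antidiag_conjugator_col gQ).
  (* An eigenvector is nonzero, hence so is [Q j j], and it can be cancelled. *)
  have [] := eigQ j; rewrite colQ scaler_eq0 negb_or => /andP[Qj0 Bj0].
  move=> [mu]; rewrite -scalemxAr scalerA mulrC -scalerA.
  by move=> /(scalerI Qj0) LB; split=> //; exists mu.
(* [B] itself serves as [Q], since its top-left blocks are again binomial matrices. *)
exists (binom_mx F n); split=> [m le_mn _ | j].
  by rewrite binom_mx_top_left; exact: binom_mx_conjugator.
split.
  apply/eqP => /colP/(_ j)/eqP.
  by rewrite !mxE binn oner_eq0.
exists (lam 0 j); rewrite /binomial_transform -col_mul mulmxKV ?binom_mx_unit //.
by apply/colP => x; rewrite mul_mx_diag !mxE mulrC.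
Qed.
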